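(* Let $m>1$ be an integer and $s=2m+2$. Let $(\xi_n)_{n\ge 1}$ be a sequence of independent identically distributed random variables taking the values $0,1,\dots,s,s+1$ with probabilities $p_0,p_1,\dots,p_s,p_{s+1}$ respectively, where $p_i\ge 0$, $p_i<1$, $\sum_{i=0}^{s+1}p_i=1$, and let $\xi=\sum_{n=1}^{\infty}s^{-n}\xi_n$. Put $$u=(p_0+p_s-p_{\frac s2})+(p_1+p_{s+1}+p_{s-1})\cos\frac{2\pi}{s}+\sum_{j=2}^{m}(p_j+p_{s-j})\cos\frac{\pi j}{m+1},$$ $$v=(p_1+p_{s+1}-p_{s-1})\sin\frac{\pi}{m+1}+\sum_{j=2}^{m}(p_j-p_{s-j})\sin\frac{\pi j}{m+1}.$$ If the distribution of $\xi$ is absolutely continuous, then $u=0=v$.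
   Context: A random variable has an absolutely continuous distribution if it takes values in any given Borel set of Lebesgue measure zero with probability $0$. *)

(* Defs.v *)
From HB Require Import structures.
From mathcomp Require Import all_boot all_order all_algebra finmap.
From mathcomp Require Import all_classical all_reals all_analysis.

Set Implicit Arguments.
Unset Strict Implicit.
Unset Printing Implicit Defensive.

Import Order.TTheory GRing.Theory Num.Theory.
Import numFieldNormedType.Exports.

Local Open Scope classical_set_scope.
Local Open Scope ring_scope.

Definition mutually_independent (d : measure_display) (T : measurableType d)
    (R : realType) (P : probability T R) (X : nat -> {RV P >-> R}) : Prop :=
  forall (J : {fset nat}) (A : nat -> set R),
    (forall k, measurable (A k)) ->
    P (\bigcap_(k in [set` J]) (X k @^-1` A k)) =
    (\prod_(k <- J) P (X k @^-1` A k))%E.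

Definition identically_distributed (d : measure_display) (T : measurableType d)
    (R : realType) (P : probability T R) (X : nat -> {RV P >-> R}) : Prop :=
  forall (j k : nat) (A : set R), measurable A ->
    distribution P (X j) A = distribution P (X k) A.

(* [lebesgue_measure] lives on the Borel sigma-algebra of [R]. *)
Definition absolutely_continuous_distribution (d : measure_display)
    (T : measurableType d) (R : realType) (P : probability T R)
    (X : {RV P >-> R}) : Prop :=
  content_dominates (@lebesgue_measure R) (distribution P X).

(* For [s = 2 * m + 2] and a law [p] on the digits [0, ..., s + 1], the numbers
   [u] and [v] below are the real and imaginary parts of
   \sum_(0 <= j <= s + 1) p j * exp (2 * i * pi * j / s).
   Only the values of [p] at [0, ..., s + 1] are used. *)
Section coefficients.
Context (R : realType) (m : nat) (p : nat -> R).
Let s : nat := (2 * m + 2)%N.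

Definition coef_u : R :=
  (p 0 + p s - p (s %/ 2))
  + (p 1 + p (s + 1) + p (s - 1)) * cos (2 * pi / s%:R)
  + \sum_(2 <= j < m.+1) (p j + p (s - j)) * cos (pi * j%:R / (m + 1)%:R).

Definition coef_v : R :=
  (p 1 + p (s + 1) - p (s - 1)) * sin (pi / (m + 1)%:R)
  + \sum_(2 <= j < m.+1) (p j - p (s - j)) * sin (pi * j%:R / (m + 1)%:R).

End coefficients.

(* Main.v *)
(* Let phi be the characteristic function of a digit; then u + i v is
   phi (2 pi / s), and phi (2 pi n) = 1 for integer n. Hence the characteristic
   function of the sum X, the product of the phi (t / s^k) over k >= 1, takes at
   t = 2 pi s^k a value a + i b that does not depend on k. The functions
   exp (2 i pi s^j x) are orthogonal on [0, 2], so their averages over j < 2^n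
   tend to 0 for Lebesgue-almost every x in [0, 2]; by absolute continuity they
   tend to 0 almost surely at x = X, and taking means gives a + i b = 0. Finally
   a + i b = phi (2 pi / s) * c, where c is the mean of exp (2 i pi Y) for a
   variable Y with values in [0, (s + 1) / (s (s - 1))], a subset of [0, 7 / 30]:
   all these angles are less than pi / 2, so c has positive real part and
   phi (2 pi / s) = 0. *)

Require Import Defs.
From HB Require Import structures.
From mathcomp Require Import all_boot all_order all_algebra finmap.
From mathcomp Require Import all_classical all_reals all_analysis.
From mathcomp Require Import ring lra zify complex measurable_realfun.

Set Implicit Arguments.
Unset Strict Implicit.
Unset Printing Implicit Defensive.

Import Order.TTheory GRing.Theory Num.Theory.
Import numFieldNormedType.Exports.

Local Open Scope classical_set_scope.
Local Open Scope ring_scope.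

(** * Orthogonal exponentials *)

Lemma sin_natpi (R : realType) (n : nat) : sin (pi * n%:R : R) = 0.
Proof.
elim: n => [|n IH]; first by rewrite mulr0 sin0.
by rewrite -natr1 mulrDr mulr1 sinDpi IH oppr0.
Qed.

Lemma integral_cos_freq (R : realType) (c : R) : c != 0 -> sin (c * 2) = 0 ->
  (\int[@lebesgue_measure R]_(x in `[0%R, 2%R]) (cos (c * x))%:E = 0)%E.
Proof.
move=> c0 sc.
pose F (x : R) : R := c^-1 * sin (c * x).
have dF (x : R) : is_derive x 1 F (cos (c * x)).
  apply: is_derive_eq; rewrite /GRing.scale /=.
  by field.
have cF : continuous F.
  by move=> x; have [/derivable1_diffP/differentiable_continuous] := dF x.
rewrite (@continuous_FTC2 _ _ F) //.
- rewrite /F sc !mulr0 sin0 mulr0; exact: subee.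
- apply: continuous_subspaceT => x.
  apply: continuous_comp; first exact: mulrl_continuous.
  exact: continuous_cos.
- split.
  + by move=> x _; apply: ex_derive.
  + exact/cvg_at_right_filter/cF.
  + exact/cvg_at_left_filter/cF.
- move=> x _; rewrite derive1E; exact: derive_val.
Qed.

Lemma integral_cos_sub (R : realType) (j k : nat) :
  (\int[@lebesgue_measure R]_(x in `[0%R, 2%R])
     (cos (2 * pi * j%:R * x - 2 * pi * k%:R * x))%:E
   = (if j == k then 2 else 0)%:E)%E.
Proof.
case: eqP => [->|/eqP jk].
  under eq_integral do rewrite subrr cos0.
  rewrite integral_cst //= lebesgue_measure_itv /= lte_fin ltr0n /=.
  by rewrite oppr0 adde0 mul1e.
have E (x : R) : 2 * pi * j%:R * x - 2 * pi * k%:R * x = (2 * pi * (j%:R - k%:R)) * x.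
  by ring.
under eq_integral do rewrite E.
apply: integral_cos_freq.
  apply: mulf_neq0; last by rewrite subr_eq0 eqr_nat.
  by apply: mulf_neq0; rewrite ?pnatr_eq0 // gt_eqF // pi_gt0.
have -> : 2 * pi * (j%:R - k%:R) * 2 = pi * (4 * j)%:R - pi * (4 * k)%:R :> R.
  rewrite !natrM; ring.
by rewrite sinB !sin_natpi mul0r mulr0 subrr.
Qed.

(** * Squared moduli of averages of exponentials *)

Section mean_square.
Context (R : realType) (a : nat -> nat).

(** This is the squared modulus of the average of exp (2 i pi a_j x) over j < N, written with
    cosines and sines so that everything stays real. *)
Definition mean_square (N : nat) (x : R) : R :=
  N%:R ^- 2 * ((\sum_(j < N) cos (2 * pi * (a j)%:R * x)) ^+ 2
             + (\sum_(j < N) sin (2 * pi * (a j)%:R * x)) ^+ 2).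

Lemma mean_square_ge0 N x : 0 <= mean_square N x.
Proof. by rewrite mulr_ge0 ?invr_ge0 ?exprn_ge0 // addr_ge0 ?sqr_ge0. Qed.

(** A squared modulus is the product with the conjugate, so phases subtract in the double sum. Both
    the bound by 1 and the integral are read off this form. *)
Lemma mean_squareE N x : mean_square N x = \sum_(j < N) \sum_(k < N)
  N%:R ^- 2 * cos (2 * pi * (a j)%:R * x - 2 * pi * (a k)%:R * x).
Proof.
rewrite /mean_square !expr2 !big_distrlr -big_split mulr_sumr.
apply: eq_bigr => j _; rewrite -big_split mulr_sumr; apply: eq_bigr => k _.
by rewrite cosB.
Qed.

Lemma mean_square_le1 N x : mean_square N x <= 1.
Proof.
rewrite mean_squareE; case: N => [|N]; first by rewrite big_ord0.
have N0 : N.+1%:R != 0 :> R by rewrite pnatr_eq0.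
apply: (@le_trans _ _ (\sum_(j < N.+1) \sum_(k < N.+1) N.+1%:R ^- 2)).
  apply: ler_sum => j _; apply: ler_sum => k _.
  by rewrite ler_piMr ?cos_le1 // invr_ge0 exprn_ge0.
rewrite !sumr_const card_ord -mulrnA -[leLHS]mulr_natr natrM.
by rewrite mulVf ?lexx // mulf_neq0.
Qed.

Lemma continuous_mean_square N : continuous (mean_square N).
Proof.
move=> x; rewrite /mean_square; under eq_fun do rewrite !expr2.
have add_cont : continuous (fun z : R * R => z.1 + z.2).
  by move=> z; apply: cvgD; [exact: cvg_fst|exact: cvg_snd].
have cc : {for x, continuous (fun y : R => \sum_(j < N) cos (2 * pi * (a j)%:R * y))}.
  apply: continuous_big => // j _ y.
  by apply: continuous_comp; [exact: mulrl_continuous|exact: continuous_cos].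
have cs : {for x, continuous (fun y : R => \sum_(j < N) sin (2 * pi * (a j)%:R * y))}.
  apply: continuous_big => // j _ y.
  by apply: continuous_comp; [exact: mulrl_continuous|exact: continuous_sin].
by apply: cvgM; [exact: cvg_cst|apply: cvgD; apply: cvgM].
Qed.

(** By orthogonality only the [N] diagonal pairs survive, each contributing 2 / N^2. *)
Lemma integral_mean_square N : injective a -> (0 < N)%N ->
  (\int[@lebesgue_measure R]_(x in `[0%R, 2%R]) (mean_square N x)%:E
    = (2 / N%:R)%:E)%E.
Proof.
move=> ainj N0.
have ic (j k : nat) : lebesgue_measure.-integrable `[0%R, 2%R]
    (fun x : R => (cos (2 * pi * (a j)%:R * x - 2 * pi * (a k)%:R * x))%:E).
  apply: continuous_compact_integrable; first exact: segment_compact.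
  apply: continuous_subspaceT => x; apply: continuous_comp; last exact: continuous_cos.
  apply: continuousB; exact: mulrl_continuous.
have ic2 (j k : nat) : lebesgue_measure.-integrable `[0%R, 2%R]
    (fun x : R => (N%:R ^- 2 * cos (2 * pi * (a j)%:R * x - 2 * pi * (a k)%:R * x))%:E).
  exact: (integrableZl _ (N%:R ^- 2) (ic j k)).
under eq_integral.
  move=> x _; rewrite mean_squareE -sumEFin.
  under eq_bigr do rewrite -sumEFin.
  over.
rewrite integral_sum //; last first.
  by move=> j; apply: integrable_sum => // k.
have -> : (2 / N%:R : R)%:E = (\sum_(j < N) (2 * N%:R ^- 2 : R)%:E)%E.
  rewrite sumEFin sumr_const card_ord -mulr_natr; congr EFin.
  field. by rewrite pnatr_eq0 -lt0n.
apply: eq_bigr => j _.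
rewrite integral_sum //.
rewrite (bigD1 j) //= big1 ?adde0.
  under eq_integral do rewrite EFinM.
  by rewrite integralZl // integral_cos_sub eqxx -EFinM mulrC.
move=> k kj.
under eq_integral do rewrite EFinM.
rewrite integralZl // integral_cos_sub inj_eq // eq_sym.
by rewrite (_ : (k == j :> nat) = false) ?mule0 //; exact: negbTE.
Qed.

(** Along N = 2^n the integrals 2 / 2^n are summable. Hence the series of mean squares has a finite
    integral, converges almost everywhere, and its terms tend to 0. *)
Lemma mean_square_cvg0 : injective a ->
  {ae @lebesgue_measure R, forall x, `[0%R, 2%R]%classic x ->
    mean_square (2 ^ n) x @[n --> \oo] --> 0}.
Proof.
move=> ainj.
have mW N : measurable_fun setT (mean_square N : measurableTypeR R -> R).
  apply: continuous_measurable_fun; exact: continuous_mean_square.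
have W0 (n : nat) x : `[0%R, 2%R]%classic x -> (0 <= (EFin \o mean_square (2 ^ n)) x)%E.
  by move=> _; rewrite lee_fin mean_square_ge0.
have mi : measurable (`[0%R, 2%R]%classic : set (measurableTypeR R)) by [].
pose F x := (\big[+%E/0%R]_(0 <= n <oo) (EFin \o mean_square (2 ^ n)) x)%E.
have iF : lebesgue_measure.-integrable `[0%R, 2%R] F.
  apply/integrableP; split.
    apply: ge0_emeasurable_sum => [n x ? _|n _]; first exact: W0.
    apply/measurable_EFinP. exact: measurable_funTS.
  under eq_integral.
    move=> x xi; rewrite gee0_abs; last first.
      by apply: nneseries_ge0 => n _ _; apply: W0; rewrite inE in xi.
    over.
  rewrite integral_nneseries //; last first.
    by move=> n; apply/measurable_EFinP; exact: measurable_funTS.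
  (* The value 2 / 2^n is rewritten as 4 / 2^(n+1) to match the geometric series of ratio one
     half. *)
  rewrite (eq_eseriesr (g := fun n => (4 / (2 ^ (n + 1))%:R)%:E)); last first.
    move=> n _; rewrite integral_mean_square ?expn_gt0 //; congr EFin.
    rewrite addn1 expnS natrM; field.
    by rewrite pnatr_eq0 -lt0n expn_gt0.
  by rewrite (cvg_lim _ (@cvg_geometric_eseries_half R 4 0)) // ltry.
have := integrable_ae mi iF.
apply: filterS => x xF xi; have {}xF := xF xi.
apply: cvg_series_cvg_0; apply: nondecreasing_is_cvgn.
  by apply: nondecreasing_series => n _ _; exact: mean_square_ge0.
exists (fine (F x)) => _ [n _ <-]; rewrite -lee_fin fineK // /series /= -sumEFin.
by apply: nneseries_lim_ge => k _ _; exact: W0.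
Qed.

End mean_square.

(** * Characteristic functions of the digits *)

Section cis.
Context (R : realType).
Local Open Scope complex_scope.

Definition cis (x : R) : R[i] := cos x +i* sin x.

Lemma cis0 : cis 0 = 1.
Proof. by rewrite /cis cos0 sin0. Qed.

Lemma cisD x y : cis (x + y) = cis x * cis y.
Proof.
rewrite /cis cosD sinD [RHS]/GRing.mul /=; congr (_ +i* _).
by rewrite addrC.
Qed.

Lemma cis_sum (I : Type) (r : seq I) (F : I -> R) :
  cis (\sum_(i <- r) F i) = \prod_(i <- r) cis (F i).
Proof. exact: (big_morph cis cisD cis0). Qed.

Lemma cis_2pi_nat (n : nat) : cis (2 * pi * n%:R) = 1.
Proof.
elim: n => [|n IH]; first by rewrite mulr0 cis0.
rewrite -[n.+1%:R]natr1 mulrDr cisD IH mul1r mulr1 mulr_natl.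
by rewrite /cis cos2pi -(add0r (pi *+ 2)) sinD2pi sin0.
Qed.

Context (s : nat) (p : nat -> R).

Definition digit_char (t : R) : R[i] := \sum_(d < s.+2) (p d)%:C * cis (t * d%:R).

Lemma digit_char_2pi_nat (n : nat) : \sum_(d < s.+2) p d = 1 ->
  digit_char (2 * pi * n%:R) = 1.
Proof.
move=> p1; transitivity (\sum_(d < s.+2) p d)%:C; last by rewrite p1.
rewrite rmorph_sum.
apply: eq_bigr => d _; have -> : 2 * pi * n%:R * d%:R = 2 * pi * (n * d)%:R :> R.
  by rewrite natrM mulrA.
by rewrite cis_2pi_nat mulr1.
Qed.

(** For independent digits of law [p], this is the characteristic function of the sum of the first
    [n] terms. The product form lets factors be split off; the link with the random variables comes
    from the expansion below. *)
Definition sum_char (n : nat) (t : R) : R[i] :=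
  \prod_(k < n) digit_char (t * s%:R ^- k.+1).

(** Expanding the product chooses a digit [f k] at each position: weights multiply and phases
    add. *)
Lemma sum_charE n t : sum_char n t =
  \sum_(f : {ffun 'I_n -> 'I_s.+2}) (\prod_(k < n) p (f k))%:C *
     cis (t * \sum_(k < n) s%:R ^- k.+1 * (f k)%:R).
Proof.
rewrite /sum_char /digit_char bigA_distr_bigA; apply: eq_bigr => f _.
rewrite big_split rmorph_prod mulr_sumr cis_sum; congr (_ * _).
by apply: eq_bigr => k _; rewrite mulrA.
Qed.

Lemma Re_sum (I : Type) (r : seq I) (F : I -> R[i]) :
  complex.Re (\sum_(i <- r) F i) = \sum_(i <- r) complex.Re (F i).
Proof. by apply: (big_morph (@complex.Re R)) => // -[a b] [c e]. Qed.

Lemma Im_sum (I : Type) (r : seq I) (F : I -> R[i]) :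
  complex.Im (\sum_(i <- r) F i) = \sum_(i <- r) complex.Im (F i).
Proof. by apply: (big_morph (@complex.Im R)) => // -[a b] [c e]. Qed.

Lemma Re_sum_char n t : complex.Re (sum_char n t) =
  \sum_(f : {ffun 'I_n -> 'I_s.+2}) (\prod_(k < n) p (f k)) *
     cos (t * \sum_(k < n) s%:R ^- k.+1 * (f k)%:R).
Proof.
by rewrite sum_charE Re_sum; apply: eq_bigr => f _; rewrite /= mul0r subr0.
Qed.

Lemma Im_sum_char n t : complex.Im (sum_char n t) =
  \sum_(f : {ffun 'I_n -> 'I_s.+2}) (\prod_(k < n) p (f k)) *
     sin (t * \sum_(k < n) s%:R ^- k.+1 * (f k)%:R).
Proof.
by rewrite sum_charE Im_sum; apply: eq_bigr => f _; rewrite /= mul0r addr0.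
Qed.

Lemma sum_charS n t : sum_char n.+1 t = digit_char (t / s%:R) * sum_char n (t / s%:R).
Proof.
rewrite /sum_char big_ord_recl expr1; congr (_ * _); apply: eq_bigr => k _.
by rewrite lift0 -mulrA exprS invfM.
Qed.

(** Each of the first [k] factors is [digit_char] at a natural multiple of 2 pi, hence equal to 1.
    The remaining factors are those of the point 2 pi. *)
Lemma sum_char_scale n k : (0 < s)%N -> \sum_(d < s.+2) p d = 1 ->
  sum_char (k + n) (2 * pi * (s ^ k)%:R) = sum_char n (2 * pi).
Proof.
move=> s0 p1; elim: k => [|k IH]; first by rewrite expn0 mulr1.
rewrite addSn sum_charS.
have -> : 2 * pi * (s ^ k.+1)%:R / s%:R = 2 * pi * (s ^ k)%:R :> R.
  by rewrite expnS natrM; field; rewrite pnatr_eq0 -lt0n.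
by rewrite digit_char_2pi_nat // mul1r IH.
Qed.

Lemma sum_geometric n : (1 < s)%N ->
  \sum_(k < n) s%:R ^- k.+1 <= (s%:R - 1)^-1 :> R.
Proof.
move=> s1; have s1' : 1 < s%:R :> R by rewrite ltr1n.
have -> : \sum_(k < n) s%:R ^- k.+1 = (1 - s%:R ^- n) / (s%:R - 1) :> R.
  elim: n => [|n IH]; first by rewrite big_ord0 invr1 subrr mul0r.
  rewrite big_ord_recr /= IH exprS. field.
  by rewrite expf_neq0 ?subr_eq0 gt_eqF //; lra.
apply: ler_piMl; first by rewrite invr_ge0; lra.
by rewrite gerBl invr_ge0 exprn_ge0.
Qed.

Lemma digit_sum_bounds n (d : 'I_n -> R) : (1 < s)%N ->
  (forall k, 0 <= d k <= s%:R + 1) ->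
  0 <= \sum_(k < n) s%:R ^- k.+1 * d k <= (s%:R + 1) / (s%:R - 1).
Proof.
move=> s1 d01; have w0 (k : nat) : 0 <= s%:R ^- k.+1 :> R.
  by rewrite invr_ge0 exprn_ge0.
apply/andP; split.
  by apply: sumr_ge0 => k _; rewrite mulr_ge0 //; have /andP[] := d01 k.
apply: (@le_trans _ _ (\sum_(k < n) s%:R ^- k.+1 * (s%:R + 1))).
  by apply: ler_sum => k _; apply: ler_wpM2l => //; have /andP[] := d01 k.
rewrite -mulr_suml mulrC; apply: ler_wpM2l; last exact: sum_geometric.
by rewrite addr_ge0.
Qed.

(** The real part is a mean of cosines of angles in [0, 14 pi / 30], where the cosine decreases. The
    bound is positive and does not depend on [n]. *)
Lemma Re_sum_char_ge n : (5 < s)%N ->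
  (forall d, (d < s.+2)%N -> 0 <= p d) -> \sum_(d < s.+2) p d = 1 ->
  cos (pi * (14 / 30)) <= complex.Re (sum_char n (2 * pi / s%:R)).
Proof.
move=> s5 p0 p1; rewrite Re_sum_char.
have pprod : \sum_(f : {ffun 'I_n -> 'I_s.+2}) (\prod_(k < n) p (f k)) = 1.
  by rewrite -(bigA_distr_bigA (fun _ d => p (val d))) big1.
rewrite -[leLHS]mul1r -[X in X * _ <= _]pprod mulr_suml; apply: ler_sum => f _.
apply: ler_wpM2l; first by apply: prodr_ge0 => k _; exact: p0.
have s6 : 6 <= s%:R :> R by rewrite ler_nat.
have digit_bounds (k : 'I_n) : 0 <= ((f k)%:R : R) <= s%:R + 1.
  by rewrite natr1 ler_nat -ltnS ltn_ord ler0n.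
have /andP := digit_sum_bounds (leq_trans (isT : 1 < 6)%N s5) digit_bounds.
have pi0 := pi_gt0 R.
set S := \sum_(k < n) _ => -[] // sum_ge0 sum_le.
have angle_le : 2 * pi / s%:R * S <= pi * (14 / 30).
  have -> : 2 * pi / s%:R * S = pi * (2 * (S / s%:R)) by ring.
  apply: ler_wpM2l; first exact: ltW.
  (* The quotient (s + 1) / (s (s - 1)) equals 7 / 30 at s = 6 and is smaller for larger [s]. *)
  have : S / s%:R <= 7 / 30; last by lra.
  rewrite ler_pdivrMr; last lra.
  apply: le_trans sum_le _; rewrite ler_pdivrMr; last lra.
  nra.
have angle_ge0 : 0 <= 2 * pi / s%:R * S.
  apply: mulr_ge0 => //; apply: divr_ge0 => //; apply: mulr_ge0 => //; exact: ltW.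
(* [ltr_cos] compares strictly, so equality of the two angles is a separate case. *)
rewrite le_eqVlt; case: (ltgtP (2 * pi / s%:R * S) (pi * (14 / 30))) angle_le => // [lt _|-> _].
  apply/orP; right; rewrite ltr_cos // in_itv /=; lra.
by rewrite eqxx.
Qed.

End cis.

(** * The numbers [coef_u] and [coef_v] as parts of [digit_char] at 2 pi / s *)

Section coefficients.
Context (R : realType) (m : nat) (p : nat -> R).
Context (m_gt1 : (1 < m)%N).
Let s : nat := (2 * m + 2)%N.

(** The digits 2, ..., m are paired with s - 2, ..., m + 2 through j -> s - j. The six digits left
    over, among them m + 1 = s / 2, are listed one by one. *)
Lemma sum_split_digits (F : nat -> R) : \sum_(d < s.+2) F d =
  F 0%N + F 1%N + F m.+1 + F (s - 1)%N + F s + F s.+1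
  + \sum_(2 <= j < m.+1) (F j + F (s - j)%N).
Proof.
rewrite -(big_mkord xpredT F) big_ltn // big_ltn //.
rewrite (@big_cat_nat _ _ _ m.+1); [|exact: ltnW|by rewrite /s; lia].
rewrite (@big_ltn _ _ _ m.+1); last by rewrite /s; lia.
(* This shape exposes the three last digits s - 1, s and s + 1, which are then peeled off the upper
   range. *)
have -> : s.+2 = (s - 1).+3 by rewrite /s; lia.
do 3![rewrite [\sum_(m.+2 <= i < _) _]big_nat_recr; last by rewrite /s; lia].
have -> : (s - 1).+2 = s.+1 by rewrite /s; lia.
have -> : (s - 1).+1 = s by rewrite /s; lia.
rewrite big_split //=.
have -> : \sum_(m.+2 <= d < s - 1) F d = \sum_(2 <= j < m.+1) F (s - j)%N.
  rewrite big_nat_rev /= (_ : m.+2 = m + 2)%N; last by rewrite addn2.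
  rewrite (_ : (s - 1)%N = m.+1 + m)%N; last by rewrite /s; lia.
  rewrite [in LHS](addnC m 2) big_addn /=.
  rewrite (_ : (m.+1 + m - m)%N = m.+1); last by lia.
  by apply: eq_big_nat => i /andP[i2 im]; congr F; rewrite /s; lia.
ring.
Qed.

Let theta (d : nat) : R := 2 * pi / s%:R * d%:R.

Let s_neq0 : s%:R != 0 :> R.
Proof. by rewrite pnatr_eq0 /s; lia. Qed.

Let thetaS : theta s = pi *+ 2.
Proof. by rewrite /theta divfK // mulr_natl. Qed.

Let theta_half : theta m.+1 = pi.
Proof.
have s2 : s%:R = 2 * m.+1%:R :> R by rewrite -natrM /s; congr _%:R; lia.
have m1 : m.+1%:R != 0 :> R by rewrite pnatr_eq0.
by rewrite /theta s2; field.
Qed.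

Let thetaSS : theta s.+1 = theta 1 + pi *+ 2.
Proof. by rewrite -thetaS /theta -mulrDr -natrD add1n. Qed.

Let thetaB j : (j <= s)%N -> theta (s - j) = - theta j + pi *+ 2.
Proof. by move=> js; rewrite -thetaS /theta natrB // mulrBr addrC. Qed.

Let thetaE j : theta j = pi * j%:R / (m + 1)%:R.
Proof.
have s2 : s%:R = 2 * (m + 1)%:R :> R by rewrite -natrM /s; congr _%:R; lia.
have m1 : (m + 1)%:R != 0 :> R by rewrite pnatr_eq0 addn1.
by rewrite /theta s2; field.
Qed.

(** Up to a full turn, digit [s] has the angle of 0, digit s + 1 that of 1, and digit s - j the
    opposite of that of j. The cosine is even, so paired weights add; s / 2 enters with cos pi =
    -1. *)
Lemma Re_digit_char_coef : complex.Re (digit_char s p (2 * pi / s%:R)) = coef_u m p.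
Proof.
rewrite /digit_char Re_sum.
rewrite (eq_bigr (fun d : 'I_s.+2 => p d * cos (theta d))); last first.
  by move=> d _; rewrite /= mul0r subr0.
rewrite (sum_split_digits (fun d => p d * cos (theta d))) thetaS thetaSS theta_half.
rewrite thetaB; last by rewrite /s; lia.
rewrite !cosD2pi cosN cos2pi cospi.
rewrite (_ : theta 0 = 0) ?cos0; last by rewrite /theta mulr0.
rewrite /coef_u -[(2 * m + 2)%N]/s (_ : (s %/ 2)%N = m.+1); last by rewrite /s; lia.
rewrite (_ : 2 * pi / s%:R = theta 1) ?(addn1 s); last by rewrite /theta mulr1.
have -> : \sum_(2 <= j < m.+1) (p j * cos (theta j) + p (s - j)%N * cos (theta (s - j)))
        = \sum_(2 <= j < m.+1) (p j + p (s - j)%N) * cos (pi * j%:R / (m + 1)%:R).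
  apply: eq_big_nat => j /andP[_ jm]; rewrite thetaB; last by rewrite /s; lia.
  by rewrite cosD2pi cosN -thetaE mulrDl.
ring.
Qed.

(** The angles reduce as for the real part. The sine is odd, so paired weights subtract, and digits
    0, s / 2 and s drop out because their angles are multiples of pi. *)
Lemma Im_digit_char_coef : complex.Im (digit_char s p (2 * pi / s%:R)) = coef_v m p.
Proof.
have sin2pi : sin (pi *+ 2) = 0 :> R by rewrite -[pi *+ 2]add0r sinD2pi sin0.
rewrite /digit_char Im_sum.
rewrite (eq_bigr (fun d : 'I_s.+2 => p d * sin (theta d))); last first.
  by move=> d _; rewrite /= mul0r addr0.
rewrite (sum_split_digits (fun d => p d * sin (theta d))) thetaS thetaSS theta_half.
rewrite thetaB; last by rewrite /s; lia.
rewrite !sinD2pi sinN sin2pi sinpi.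
rewrite (_ : theta 0 = 0) ?sin0; last by rewrite /theta mulr0.
rewrite /coef_v -[(2 * m + 2)%N]/s.
rewrite (_ : pi / (m + 1)%:R = theta 1) ?(addn1 s); last by rewrite thetaE mulr1.
have -> : \sum_(2 <= j < m.+1) (p j * sin (theta j) + p (s - j)%N * sin (theta (s - j)))
        = \sum_(2 <= j < m.+1) (p j - p (s - j)%N) * sin (pi * j%:R / (m + 1)%:R).
  apply: eq_big_nat => j /andP[_ jm]; rewrite thetaB; last by rewrite /s; lia.
  by rewrite sinD2pi sinN -thetaE mulrN mulrBl.
ring.
Qed.

End coefficients.

(** * Laws of the digits and of their sum *)

Section bounded_convergence.
Context d (T : measurableType d) (R : realType) (P : probability T R).

Lemma integrable_bounded (f : T -> R) (M : R) : measurable_fun setT f ->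
  (forall w, `|f w| <= M) -> P.-integrable setT (EFin \o f).
Proof.
move=> mf fM; apply: measurable_bounded_integrable => //.
  by rewrite [X in (X < _)%E](@probability_setT _ _ _ P) ltry.
exists M; split; first exact: num_real.
by move=> x Mx w _; exact: le_trans (fM w) (ltW Mx).
Qed.

Lemma Rintegral_sum (I : Type) (r : seq I) (f : I -> T -> R) :
  (forall i, P.-integrable setT (EFin \o f i)) ->
  \int[P]_w (\sum_(i <- r) f i w) = \sum_(i <- r) \int[P]_w f i w.
Proof.
move=> fi; elim: r => [|i r IH].
  rewrite big_nil; under eq_Rintegral do rewrite big_nil.
  by rewrite Rintegral_cst // mul0r.
rewrite big_cons -IH; under eq_Rintegral do rewrite big_cons.
rewrite RintegralD //.
rewrite (_ : EFin \o _ = fun w => (\sum_(j <- r) (f j w)%:E)%E).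
  by apply: integrable_sum => // j _; exact: fi.
by apply/funext => w /=; rewrite sumEFin.
Qed.

Lemma bounded_convergence (f_ : nat -> T -> R) (f : T -> R) (M : R) :
  (forall n, measurable_fun setT (f_ n)) -> measurable_fun setT f ->
  (forall n w, `|f_ n w| <= M) ->
  {ae P, forall w, f_ n w @[n --> \oo] --> f w} ->
  \int[P]_w f_ n w @[n --> \oo] --> \int[P]_w f w.
Proof.
move=> mf_ mf f_M f_f; apply: fine_cvg.
have [] := @dominated_convergence _ _ _ P setT measurableT
  (fun n => EFin \o f_ n) (EFin \o f) (cst M%:E).
- by move=> n; exact/measurable_EFinP.
- exact/measurable_EFinP.
- by apply: filterS f_f => w fw _; apply: cvg_EFin => //; exact: nearW.
- by apply: (@integrable_bounded (cst M) `|M|) => //.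
- by apply: aeW => w n _; rewrite lee_fin.
move=> fi _; rewrite fineK //.
exact: integrable_fin_num.
Qed.

(** The exceptional points lie in a Borel null set, whose preimage under [X] has probability 0 by
    absolute continuity. *)
Lemma ac_distribution_ae (X : {RV P >-> R}) (Q : R -> Prop) :
  absolutely_continuous_distribution X ->
  {ae @lebesgue_measure R, forall x, Q x} -> {ae P, forall w, Q (X w)}.
Proof.
move=> Xac [B [mB B0 QB]]; exists (X @^-1` B); split.
- by rewrite -[X in measurable X]setTI; exact: measurable_funP.
- exact: Xac.
- by move=> w /= nQ; exact: QB.
Qed.

End bounded_convergence.

(** * Joint law of the first digits *)

Section digits.
Context d (T : measurableType d) (R : realType) (P : probability T R) (s : nat).
Context (p : nat -> R) (xi : nat -> {RV P >-> R}).
Context (p_sum1 : \sum_(i < s.+2) p i = 1).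
Context (xi_indep : mutually_independent xi).
Context (xi_law : forall k i : nat, (i < s.+2)%N -> P [set w | xi k w = i%:R] = (p i)%:E).

Lemma digit_measurable k (x : R) : measurable [set w | xi k w = x].
Proof.
rewrite [X in measurable X](_ : _ = setT `&` xi k @^-1` [set x]); last by rewrite setTI.
by apply: measurable_funP.
Qed.

(** For each [k] the events that the digit equals i are disjoint, and their probabilities already
    add up to 1. *)
Lemma ae_digits : {ae P, forall w, forall k, exists i : 'I_s.+2, xi k w = i%:R}.
Proof.
apply: ae_foralln => k.
pose A (i : nat) := [set w | xi k w = i%:R].
have mA : measurable (\big[setU/set0]_(i < s.+2) A i).
  by apply: bigsetU_measurable => i _; exact: digit_measurable.
exists (~` \big[setU/set0]_(i < s.+2) A i); split.
- exact: measurableC.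
- transitivity (1 - P (\big[setU/set0]_(i < s.+2) A i))%E.
    exact: probability_setC.
  rewrite measure_bigsetU //.
  + rewrite (eq_bigr (fun i : 'I_s.+2 => (p i)%:E)) => [|i _]; last exact: xi_law.
    by rewrite sumEFin p_sum1 subee.
  + by move=> i; exact: digit_measurable.
  + move=> i j _ _ [w [iw jw]]; apply/eqP.
    by rewrite -(@eqr_nat R) -[i%:R]iw -[j%:R]jw.
- move=> w /= nw; rewrite -bigcup_mkord => -[i /= si wi].
  by apply: nw; exists (Ordinal si).
Qed.

Lemma joint_law n (a : nat -> nat) : (forall k, (a k < s.+2)%N) ->
  P [set w | forall k, (k < n)%N -> xi k w = (a k)%:R] = (\prod_(k < n) p (a k))%:E.
Proof.
move=> sa.
have := xi_indep [fset k in iota 0 n]%fset (fun k => measurable_set1 (a k)%:R).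
rewrite (perm_big (iota 0 n)) /=; last first.
  by apply: uniq_perm; rewrite ?iota_uniq ?fset_uniq // => k; rewrite in_fset.
rewrite (eq_bigr (fun k => (p (a k))%:E)) => [|k _]; last exact: xi_law.
rewrite [X in _ = X -> _](_ : _ = (\prod_(0 <= k < n) (p (a k))%:E)%E); last first.
  by rewrite /index_iota subn0.
rewrite prodEFin big_mkord => <-.
congr (P _); apply/seteqP; split => w /= H k.
  rewrite /= in_fset mem_iota add0n => /= kn. exact: H.
by move=> kn; apply: H; rewrite /= in_fset mem_iota add0n.
Qed.

(** Almost surely exactly one of the finitely many digit words [f] occurs, so [H] agrees almost
    everywhere with a combination of indicators whose probabilities are known by independence. *)
Lemma expectation_digits n (H : T -> R) (g : {ffun 'I_n -> 'I_s.+2} -> R) :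
  measurable_fun setT H ->
  (forall w (f : {ffun 'I_n -> 'I_s.+2}),
    (forall k : 'I_n, xi k w = (f k)%:R) -> H w = g f) ->
  \int[P]_w H w = \sum_(f : {ffun 'I_n -> 'I_s.+2}) (\prod_(k < n) p (f k)) * g f.
Proof.
move=> mH Hg.
pose A (f : {ffun 'I_n -> 'I_s.+2}) := [set w | forall k : 'I_n, xi k w = (f k)%:R].
have mA f : measurable (A f).
  rewrite (_ : A f = \bigcap_(k in [set: 'I_n]) [set w | xi k w = (f k)%:R]).
    by apply: fin_bigcap_measurable => [|k _]; [exact: finite_finset|exact: digit_measurable].
  by apply/seteqP; split => w /= h k; [move=> _; exact: h|exact: h].
have PA f : P (A f) = (\prod_(k < n) p (f k))%:E.
  (* [joint_law] takes a digit for every natural number, so the word [f] is continued by 0 beyond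
     [n]. *)
  pose a (k : nat) : nat := oapp (fun i : 'I_n => f i : nat) 0%N (insub k).
  have aE (k : 'I_n) : a k = f k.
    by rewrite /a; case: insubP => [i _ /val_inj ->|] //; rewrite ltn_ord.
  rewrite (eq_bigr (fun k : 'I_n => p (a k))) => [|k _]; last by rewrite aE.
  rewrite -joint_law => [|k]; last by rewrite /a; case: (insub k) => /=.
  congr (P _); apply/seteqP; split => w /= h k.
    by move=> kn; have := h (Ordinal kn); rewrite -aE.
  by rewrite -aE; exact: h.
transitivity (\int[P]_w \sum_f g f * \1_(A f) w).
  congr fine; apply: ae_eq_integral => //.
  - exact/measurable_EFinP.
  - apply/measurable_EFinP; apply: measurable_sum => f.
    by apply: measurable_funM => //; exact: measurable_indic.
  apply: filterS ae_digits => w wd _; congr EFin.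
  have /fin_all_exists[h hw] : forall k : 'I_n, exists i : 'I_s.+2, xi k w = i%:R.
    by move=> k; exact: wd.
  pose f := [ffun k => h k].
  have Af : w \in A f by rewrite inE => k; rewrite ffunE.
  rewrite (Hg w f) => [|k]; last by rewrite ffunE.
  rewrite (bigD1 f) //= indicE Af mulr1 big1 ?addr0 // => f' ff'.
  rewrite indicE; case: (boolP (w \in A f')) => [|_]; last by rewrite mulr0.
  rewrite inE => Af'; case/eqP: ff'; apply/ffunP => k; apply/val_inj/eqP.
  by rewrite -(@eqr_nat R) -Af' ffunE hw.
rewrite Rintegral_sum; last first.
  move=> f; apply: (@integrable_bounded _ _ _ _ _ `|g f|).
    by apply: measurable_funM => //; exact: measurable_indic.
  move=> w; rewrite normrM ler_piMr // indicE; case: (w \in A f);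
  by rewrite ?normr1 ?normr0.
apply: eq_bigr => f _; rewrite RintegralZl //; last first.
  apply: (@integrable_bounded _ _ _ _ _ 1); first exact: measurable_indic.
  by move=> w; rewrite indicE; case: (w \in A f); rewrite ?normr1 ?normr0.
rewrite mulrC (_ : \prod_(k < n) _ = fine (P (A f))); last by rewrite PA.
by rewrite /Rintegral integral_indic // setIT.
Qed.

End digits.

(** * Characteristic function of the infinite sum *)

Section limit_law.
Context d (T : measurableType d) (R : realType) (P : probability T R) (s : nat).
Context (p : nat -> R) (xi : nat -> {RV P >-> R}) (X : {RV P >-> R}).
Context (s_gt5 : (5 < s)%N).
Context (p_ge0 : forall i, (i < s.+2)%N -> 0 <= p i).
Context (p_sum1 : \sum_(i < s.+2) p i = 1).
Context (xi_indep : mutually_independent xi).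
Context (xi_law : forall k i : nat, (i < s.+2)%N -> P [set w | xi k w = i%:R] = (p i)%:E).
Context (X_sum : {ae P, forall w : T,
  series (fun k : nat => (s%:R ^- k.+1 : R) * xi k w) n @[n --> \oo] --> X w}).

Let partial_sum n w : R := \sum_(k < n) s%:R ^- k.+1 * xi k w.

Let measurable_RV (Y : {RV P >-> R}) : measurable_fun setT Y.
Proof. exact: measurable_funPT. Qed.

Let measurable_cosM (t : R) (f : T -> R) :
  measurable_fun setT f -> measurable_fun setT (fun w => cos (t * f w)).
Proof.
move=> mf; apply: (@measurableT_comp _ _ _ _ _ _ cos).
  by apply: continuous_measurable_fun; exact: continuous_cos.
exact: measurable_funM.
Qed.

Let measurable_sinM (t : R) (f : T -> R) :
  measurable_fun setT f -> measurable_fun setT (fun w => sin (t * f w)).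
Proof.
move=> mf; apply: (@measurableT_comp _ _ _ _ _ _ sin).
  by apply: continuous_measurable_fun; exact: continuous_sin.
exact: measurable_funM.
Qed.

Let measurable_partial_sum n : measurable_fun setT (partial_sum n).
Proof. by apply: measurable_sum => k; exact: measurable_funM. Qed.

Let ae_partial_sum_cvg : {ae P, forall w, partial_sum n w @[n --> \oo] --> X w}.
Proof.
apply: filterS X_sum => w; rewrite (_ : series _ = partial_sum^~ w) //.
by apply/funext => n; rewrite /series /= big_mkord.
Qed.

Let norm_cos_le1 (x : R) : `|cos x| <= 1.
Proof. by rewrite ler_norml cos_geN1 cos_le1. Qed.

Let norm_sin_le1 (x : R) : `|sin x| <= 1.
Proof. by rewrite ler_norml sin_geN1 sin_le1. Qed.

(** The left side is the mean of cos (t S_n) for the partial sum S_n, and cosines are bounded by 1,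
    so bounded convergence applies. *)
Lemma Re_sum_char_cvg t :
  complex.Re (sum_char s p n t) @[n --> \oo] --> \int[P]_w cos (t * X w).
Proof.
have E n : complex.Re (sum_char s p n t) = \int[P]_w cos (t * partial_sum n w).
  rewrite Re_sum_char; apply/esym.
  apply: (expectation_digits p_sum1 xi_indep xi_law) => [|w f xif].
    exact: measurable_cosM.
  by congr (cos (t * _)); apply: eq_bigr => k _; rewrite xif.
under eq_cvg do rewrite E.
apply: (@bounded_convergence _ _ _ _ _ _ 1) => //.
- by move=> n; exact: measurable_cosM.
- exact: measurable_cosM.
- apply: filterS ae_partial_sum_cvg => w Xw.
  have tX : t * partial_sum n w @[n --> \oo] --> t * X w.
    by apply: cvgM => //; exact: cvg_cst.
  exact: (cvg_comp _ cos tX (@continuous_cos R _)).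
Qed.

Lemma Im_sum_char_cvg t :
  complex.Im (sum_char s p n t) @[n --> \oo] --> \int[P]_w sin (t * X w).
Proof.
have E n : complex.Im (sum_char s p n t) = \int[P]_w sin (t * partial_sum n w).
  rewrite Im_sum_char; apply/esym.
  apply: (expectation_digits p_sum1 xi_indep xi_law) => [|w f xif].
    exact: measurable_sinM.
  by congr (sin (t * _)); apply: eq_bigr => k _; rewrite xif.
under eq_cvg do rewrite E.
apply: (@bounded_convergence _ _ _ _ _ _ 1) => //.
- by move=> n; exact: measurable_sinM.
- exact: measurable_sinM.
- apply: filterS ae_partial_sum_cvg => w Xw.
  have tX : t * partial_sum n w @[n --> \oo] --> t * X w.
    by apply: cvgM => //; exact: cvg_cst.
  exact: (cvg_comp _ sin tX (@continuous_sin R _)).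
Qed.

(** The partial sums lie between 0 and (s + 1) / (s - 1) <= 2. This places [X] in the interval on
    which the averages of exponentials were shown to vanish in the limit. *)
Lemma ae_sum_range : {ae P, forall w, `[0%R, 2%R]%classic (X w)}.
Proof.
have := ae_digits p_sum1 xi_law.
apply: filterS2 ae_partial_sum_cvg => w Xw digits.
have s6 : 6 <= s%:R :> R by rewrite ler_nat.
have xi_bounds k : 0 <= (xi k w : R) <= s%:R + 1.
  by have [i ->] := digits k; rewrite natr1 ler_nat -ltnS ltn_ord ler0n.
have le2 : (s%:R + 1) / (s%:R - 1) <= 2 :> R by rewrite ler_pdivrMr; lra.
have sum_bounds n : 0 <= partial_sum n w <= 2.
  have /andP[-> /le_trans ->] // := digit_sum_bounds (leq_trans (isT : 1 < 6)%N s_gt5)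
    (fun k : 'I_n => xi_bounds k).
rewrite /= in_itv /=; apply/andP; split.
- rewrite -(cvg_lim _ Xw) //; apply: limr_ge; first exact: cvgP Xw.
  by apply: nearW => n; have /andP[] := sum_bounds n.
- rewrite -(cvg_lim _ Xw) //; apply: limr_le; first exact: cvgP Xw.
  by apply: nearW => n; have /andP[] := sum_bounds n.
Qed.

(** Both sides are limits of the same sequence: by [sum_char_scale], dropping [k] terms of the one
    gives the other. *)
Lemma Re_char_scale k : \int[P]_w cos (2 * pi * (s ^ k)%:R * X w) = \int[P]_w cos (2 * pi * X w).
Proof.
have s0 : (0 < s)%N by exact: leq_trans s_gt5.
have shift n : complex.Re (sum_char s p (n + k) (2 * pi * (s ^ k)%:R)) =
    complex.Re (sum_char s p n (2 * pi)) by rewrite addnC sum_char_scale.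
have := Re_sum_char_cvg (t := 2 * pi * (s ^ k)%:R).
rewrite -(cvg_shiftn k) (eq_cvg _ _ shift) => /cvg_lim <- //.
by apply/cvg_lim => //; exact: Re_sum_char_cvg.
Qed.

Lemma Im_char_scale k : \int[P]_w sin (2 * pi * (s ^ k)%:R * X w) = \int[P]_w sin (2 * pi * X w).
Proof.
have s0 : (0 < s)%N by exact: leq_trans s_gt5.
have shift n : complex.Im (sum_char s p (n + k) (2 * pi * (s ^ k)%:R)) =
    complex.Im (sum_char s p n (2 * pi)) by rewrite addnC sum_char_scale.
have := Im_sum_char_cvg (t := 2 * pi * (s ^ k)%:R).
rewrite -(cvg_shiftn k) (eq_cvg _ _ shift) => /cvg_lim <- //.
by apply/cvg_lim => //; exact: Im_sum_char_cvg.
Qed.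

Context (X_ac : absolutely_continuous_distribution X).

Let a := \int[P]_w cos (2 * pi * X w).
Let b := \int[P]_w sin (2 * pi * X w).
Let freq j := (s ^ j)%N.

Let measurable_mean_square N : measurable_fun setT (fun w => mean_square freq N (X w)).
Proof.
apply: (@measurableT_comp _ _ _ _ _ _ (mean_square freq N)) => //.
by apply: continuous_measurable_fun; exact: continuous_mean_square.
Qed.

Let norm_mean_square N w : `|mean_square freq N (X w)| <= 1.
Proof. by rewrite ger0_norm ?mean_square_ge0 // mean_square_le1. Qed.

Lemma mean_square_expectation_cvg0 :
  \int[P]_w mean_square freq (2 ^ n) (X w) @[n --> \oo] --> 0.
Proof.
have ->: 0 = \int[P]_w (0 : R) by rewrite Rintegral_cst // mul0r.
apply: (@bounded_convergence _ _ _ _ _ (fun=> 0) 1) => //.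
have freq_inj : injective freq by move=> i j /eqP; rewrite eqn_exp2l ?(leq_trans _ s_gt5) // => /eqP.
have := ac_distribution_ae X_ac (mean_square_cvg0 R freq_inj).
by apply: filterS2 ae_sum_range => w Xw; exact.
Qed.

(* Jensen, through the tangent inequality x ^ 2 >= 2 a x - a ^ 2: by scale
   invariance, a + i b is the mean of the average of exp (2 i pi s^j X), j < N. *)
Lemma mean_square_expectation_ge N : (0 < N)%N ->
  a ^+ 2 + b ^+ 2 <= \int[P]_w mean_square freq N (X w).
Proof.
move=> N0; have N0' : N%:R != 0 :> R by rewrite pnatr_eq0 -lt0n.
(* Summed over j < N, these are the linear parts of the tangent bounds at [a] and [b]. Each [h j]
   has mean 2 (a^2 + b^2) / N, so subtracting a^2 + b^2 from the sum leaves mean a^2 + b^2. *)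
pose h j w := (2 * a / N%:R) * cos (2 * pi * (freq j)%:R * X w)
            + (2 * b / N%:R) * sin (2 * pi * (freq j)%:R * X w).
have ic j : P.-integrable setT (EFin \o fun w => cos (2 * pi * (freq j)%:R * X w)).
  by apply: (@integrable_bounded _ _ _ _ _ 1) => //; exact: measurable_cosM.
have isn j : P.-integrable setT (EFin \o fun w => sin (2 * pi * (freq j)%:R * X w)).
  by apply: (@integrable_bounded _ _ _ _ _ 1) => //; exact: measurable_sinM.
have icZ (r : R) j : P.-integrable setT
    (EFin \o fun w => r * cos (2 * pi * (freq j)%:R * X w)).
  exact: (integrableZl _ r (ic j)).
have isZ (r : R) j : P.-integrable setT
    (EFin \o fun w => r * sin (2 * pi * (freq j)%:R * X w)).
  exact: (integrableZl _ r (isn j)).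
have ih j : P.-integrable setT (EFin \o h j).
  exact: (integrableD _ (icZ (2 * a / N%:R) j) (isZ (2 * b / N%:R) j)).
have Eh j : \int[P]_w h j w = 2 * a ^+ 2 / N%:R + 2 * b ^+ 2 / N%:R.
  rewrite /h RintegralD //.
  rewrite !RintegralZl // Re_char_scale Im_char_scale -/a -/b; ring.
have isum : P.-integrable setT (EFin \o fun w => \sum_(j < N) h j w).
  rewrite (_ : EFin \o _ = fun w => (\sum_(j < N) (h j w)%:E)%E).
    by apply: integrable_sum => // j _; exact: ih.
  by apply/funext => w /=; rewrite sumEFin.
have icst : P.-integrable setT (EFin \o fun=> a ^+ 2 + b ^+ 2).
  by apply: (@integrable_bounded _ _ _ _ _ `|a ^+ 2 + b ^+ 2|).
have -> : a ^+ 2 + b ^+ 2 = \int[P]_w (\sum_(j < N) h j w - (a ^+ 2 + b ^+ 2)).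
  rewrite RintegralB // Rintegral_sum; last by move=> j; exact: ih.
  under eq_bigr do rewrite Eh.
  rewrite sumr_const card_ord -mulr_natr Rintegral_cst //.
  rewrite [fine _](_ : _ = 1); last exact: (congr1 fine (probability_setT P)).
  by field.
apply: le_Rintegral => //.
- exact: (integrableB _ isum icst).
- exact: (@integrable_bounded _ _ _ _ _ 1).
move=> w _; rewrite /mean_square /h big_split -!mulr_sumr.
set C := \sum_(j < N) cos _; set S := \sum_(j < N) sin _.
rewrite -subr_ge0.
(* The gap in the tangent inequality is the squared distance from the average to a + i b. *)
have -> : N%:R ^- 2 * (C ^+ 2 + S ^+ 2) -
    (2 * a / N%:R * C + 2 * b / N%:R * S - (a ^+ 2 + b ^+ 2)) =
    (C / N%:R - a) ^+ 2 + (S / N%:R - b) ^+ 2 by field.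
by rewrite addr_ge0 ?sqr_ge0.
Qed.

Lemma char_eq0 : a = 0 /\ b = 0.
Proof.
have : a ^+ 2 + b ^+ 2 <= 0.
  have := mean_square_expectation_cvg0 => c0.
  rewrite -(cvg_lim _ c0) //; apply: limr_ge; first exact: cvgP c0.
  by apply: nearW => n; apply: mean_square_expectation_ge; rewrite expn_gt0.
move=> ab; have a2 := sqr_ge0 a; have b2 := sqr_ge0 b.
by split; apply/eqP; rewrite -sqrf_eq0; apply/eqP; lra.
Qed.

(** Splitting off the first factor at 2 pi leaves [D] times [sum_char] at 2 pi / s, whose modulus is
    at least [c] > 0 for every [n]. The squared modulus [G] of the whole product tends to a^2 + b^2
    = 0, which forces [D] = 0. The uniform bound spares passing to the limit in the second
    factor. *)
Lemma digit_char_eq0 : digit_char s p (2 * pi / s%:R) = 0.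
Proof.
set D := digit_char _ _ _.
pose c : R := cos (pi * (14 / 30)).
have c0 : 0 < c by apply: cos_gt0_pihalf; have := pi_gt0 R; lra.
have [a0 b0] := char_eq0.
have := Re_sum_char_cvg (t := 2 * pi); rewrite -/a a0 => re0.
have := Im_sum_char_cvg (t := 2 * pi); rewrite -/b b0 => im0.
pose G n := complex.Re (sum_char s p n (2 * pi)) ^+ 2 + complex.Im (sum_char s p n (2 * pi)) ^+ 2.
have G0 : G n @[n --> \oo] --> (0 : R).
  rewrite (_ : 0 = 0 * 0 + 0 * 0 :> R); last by rewrite mulr0 addr0.
  by under eq_cvg do rewrite /G !expr2; apply: cvgD; apply: cvgM.
have Gge n : (complex.Re D ^+ 2 + complex.Im D ^+ 2) * c ^+ 2 <= G n.+1.
  have cG : c <= complex.Re (sum_char s p n (2 * pi / s%:R)).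
    by apply: Re_sum_char_ge => //.
  rewrite /G sum_charS -/D.
  case: (sum_char s p n _) cG => g h /= cg; case: (D) => u v /=.
  (* The squared modulus is multiplicative. *)
  have -> : (u * g - v * h) ^+ 2 + (u * h + v * g) ^+ 2 = (u ^+ 2 + v ^+ 2) * (g ^+ 2 + h ^+ 2).
    by ring.
  apply: ler_wpM2l; first by rewrite addr_ge0 ?sqr_ge0.
  have := sqr_ge0 h; have : c ^+ 2 <= g ^+ 2 by rewrite lerXn2r // nnegrE; lra.
  lra.
have : (complex.Re D ^+ 2 + complex.Im D ^+ 2) * c ^+ 2 <= 0.
  move: G0; rewrite -(cvg_shiftn 1) => G0.
  rewrite -(cvg_lim _ G0) //; apply: limr_ge; first exact: cvgP G0.
  by apply: nearW => n; rewrite /= addn1.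
rewrite pmulr_lle0 ?exprn_gt0 //.
case: (D) => u v /= uv; have u2 := sqr_ge0 u; have v2 := sqr_ge0 v.
have /eqP : u ^+ 2 = 0 by lra.
have /eqP : v ^+ 2 = 0 by lra.
by rewrite !sqrf_eq0 => /eqP -> /eqP ->.
Qed.

End limit_law.

(* [xi k] is the (k+1)-th digit, so it has weight s ^ -(k+1) in the sum [X]. *)
Theorem corollary5 (R : realType) (d : measure_display) (T : measurableType d)
    (P : probability T R) (m s : nat) (hm : (1 < m)%N) (hs : s = (2 * m + 2)%N)
    (p : nat -> R)
    (p_ge0 : forall i : nat, (i <= s + 1)%N -> 0 <= p i)
    (p_lt1 : forall i : nat, (i <= s + 1)%N -> p i < 1)
    (p_sum1 : \sum_(0 <= i < s + 2) p i = 1)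
    (xi : nat -> {RV P >-> R})
    (xi_indep : mutually_independent xi)
    (xi_id : identically_distributed xi)
    (xi_law : forall k i : nat, (i <= s + 1)%N ->
      P [set w | xi k w = i%:R] = (p i)%:E)
    (X : {RV P >-> R})
    (X_sum : {ae P, forall w : T,
      series (fun k : nat => (s%:R ^- k.+1 : R) * xi k w) n @[n --> \oo] --> X w})
    (X_ac : absolutely_continuous_distribution X) :
  coef_u m p = 0 /\ coef_v m p = 0.
Proof.
subst s; pose s := (2 * m + 2)%N.
have s_gt5 : (5 < s)%N by rewrite /s; lia.
have ltS i : (i < s.+2)%N -> (i <= s + 1)%N by rewrite addn1 ltnS.
have p0 i : (i < s.+2)%N -> 0 <= p i by move/ltS; exact: p_ge0.
have p1 : \sum_(i < s.+2) p i = 1 by rewrite -p_sum1 big_mkord addn2.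
have law k i : (i < s.+2)%N -> P [set w | xi k w = i%:R] = (p i)%:E.
  by move/ltS; exact: xi_law.
have D0 := digit_char_eq0 s_gt5 p0 p1 xi_indep law X_sum X_ac.
by rewrite -Re_digit_char_coef // -Im_digit_char_coef // D0.
Qed.
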